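(* Let $X,Y$ be real Hilbert spaces, $A:X\to Y$ a bounded linear ill-posed operator, $y\in Rg(A)$ and $x_0\in X$. Let $(x_k)$, $(w_k)$ be sequences generated by the exact-data iniT algorithm (described in the context) with initial guess $x_0$, constant $\alpha$, and parameter sequences $(\lambda_k)_{k\ge 0}$ and $(\alpha_k)$. Assume that: (A1) $(\alpha_k)$ is chosen as follows, for some nonnegative sequence $(\theta_k)_{k\ge 0}$ with $\sum_k\theta_k<\infty$: $\alpha_0=\alpha$ and, for $k\ge 1$, $\alpha_k=\min\{\theta_k/\|x_k-x_{k-1}\|^2,\ \theta_k,\ \alpha\}$ if $\|x_k-x_{k-1}\|>0$, and $\alpha_k=0$ otherwise; (A2) $(\alpha_k)$ is monotone non-increasing and $\alpha<\frac12$; (A3) there is a constant $\lambda>0$ such that $\lambda_k\ge\lambda$ for all $k\ge 0$. Then either the sequence $(x_k)$ stops after a finite number $k_0\in\mathbb{N}$ of steps (in this case $Ax_{k_0}=y$), or it converges strongly to $x^\dagger$, the $x_0$-minimal norm solution of $Ax=y$.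
   Context: Ill-posed means that the inverse $A^{-1}:Y\to X$ either does not exist or is not continuous. $A^*:Y\to X$ is the adjoint of $A$ and $Rg(A)$ is the range of $A$. Exact-data iniT (inertial iterated Tikhonov) algorithm: choose $x_0\in X$ and set $x_{-1}:=x_0$; choose $\alpha\in[0,1)$ and a sequence of nonnegative reals $(\lambda_k)_{k\ge0}$. For $k=0,1,2,\dots$, as long as $\|Ax_k-y\|>0$: choose $\alpha_k\in[0,\alpha]$, set $w_k:=x_k+\alpha_k(x_k-x_{k-1})$, and let $x_{k+1}\in X$ be the unique solution of $\lambda_kA^*(Ax_{k+1}-y)+x_{k+1}-w_k=0$. If $Ax_{k_0}=y$ for some (first) $k_0$, the iteration stops, having produced $x_{-1},x_0,\dots,x_{k_0}$ and $w_0,\dots,w_{k_0-1}$; otherwise infinite sequences are produced. The $x_0$-minimal norm solution $x^\dagger$ of $Ax=y$ is the unique $x^\dagger\in X$ with $Ax^\dagger=y$ and $\|x^\dagger-x_0\|=\inf\{\|x-x_0\|:\ x\in X,\ Ax=y\}$. *)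

(* Defs.v *)
From HB Require Import structures.
From mathcomp Require Import all_boot all_order all_algebra.
From mathcomp Require Import all_classical all_reals all_analysis.

Set Implicit Arguments.
Unset Strict Implicit.
Unset Printing Implicit Defensive.

Import Order.TTheory GRing.Theory Num.Theory.
Import numFieldNormedType.Exports.

Local Open Scope classical_set_scope.
Local Open Scope ring_scope.

(* A real Hilbert space is a [completeNormedModType R] together with a positive
   definite symmetric bilinear form (idfun: no conjugation) inducing its norm. *)
Definition induces_norm (R : realType) (X : normedModType R)
    (dot : {dot X for (idfun : R -> R)}) : Prop :=
  forall x : X, `|x| = Num.sqrt (dot x x).

Section Operators.
Context {R : realType} {X Y : completeNormedModType R}.

Definition bounded_operator (A : X -> Y) : Prop :=
  exists M : R, forall x : X, `|A x| <= M * `|x|.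

Definition is_adjoint (dotX : {dot X for (idfun : R -> R)})
    (dotY : {dot Y for (idfun : R -> R)}) (A : X -> Y) (Astar : Y -> X) : Prop :=
  forall (x : X) (z : Y), dotY (A x) z = dotX x (Astar z).

(* The inverse is a map defined on the whole of Y. *)
Definition ill_posed (A : X -> Y) : Prop :=
  ~ (exists B : Y -> X, [/\ cancel A B, cancel B A & continuous B]).

Definition min_norm_solution (A : X -> Y) (y : Y) (x0 xdag : X) : Prop :=
  A xdag = y /\ `|xdag - x0| = inf [set `|x - x0| | x in [set x | A x = y]].

(* The convention x_{-1} = x_0. *)
Definition previous (x : nat -> X) (k : nat) : X :=
  if k is j.+1 then x j else x 0%N.

(* The loop body is executed at step k.  A run that stops at k0 is represented
   by total sequences x, w, alphak of which only x_0, ..., x_k0, and w_k and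
   alpha_k for k < k0, are meaningful: nothing is required of the other terms. *)
Definition active (A : X -> Y) (y : Y) (x : nat -> X) (k : nat) : Prop :=
  forall j : nat, (j <= k)%N -> 0 < `|A (x j) - y|.

Definition iniT (A : X -> Y) (Astar : Y -> X) (y : Y) (x0 : X) (alpha : R)
    (lambdak alphak : nat -> R) (x w : nat -> X) : Prop :=
  [/\ x 0%N = x0,
      0 <= alpha < 1,
      forall k : nat, 0 <= lambdak k &
      forall k : nat, active A y x k ->
        [/\ 0 <= alphak k <= alpha,
            w k = x k + alphak k *: (x k - previous x k) &
            lambdak k *: Astar (A (x k.+1) - y) + x k.+1 - w k = 0]].

Definition stops_at (A : X -> Y) (y : Y) (x : nat -> X) (k0 : nat) : Prop :=
  A (x k0) = y /\ forall j : nat, (j < k0)%N -> 0 < `|A (x j) - y|.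

Definition inertia_rule (A : X -> Y) (y : Y) (alpha : R) (theta alphak : nat -> R)
    (x : nat -> X) : Prop :=
  forall k : nat, active A y x k ->
    alphak k =
      if k == 0%N then alpha
      else if 0 < `|x k - previous x k| then
        Num.min (Num.min (theta k / `|x k - previous x k| ^+ 2) (theta k)) alpha
      else 0.

Definition inertia_nonincreasing (A : X -> Y) (y : Y) (alphak : nat -> R)
    (x : nat -> X) : Prop :=
  forall i j : nat, (i <= j)%N -> active A y x j -> alphak j <= alphak i.

End Operators.

(* Main.v *)
Require Import Defs.
From HB Require Import structures.
From mathcomp Require Import all_boot all_order all_algebra.
From mathcomp Require Import all_classical all_reals all_analysis.
From mathcomp Require Import ring lra.

Set Implicit Arguments.
Unset Strict Implicit.
Unset Printing Implicit Defensive.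

Import Order.TTheory GRing.Theory Num.Theory.
Import numFieldNormedType.Exports.

Local Open Scope classical_set_scope.
Local Open Scope ring_scope.

(** If no iterate solves [A u = y], the method is the
    iterated Tikhonov method perturbed by the inertial terms
    [i k = alphak k *: (x k - x k.-1)],

      [x k.+1 = x k + i k - lambdak k *: A^* (A (x k.+1) - y)],

    and the cap on [alphak] gives [`|i k| <= theta k] ([inertia_le]), so that
    the perturbations are absolutely summable.

    Let [xs] be a solution and [p k = `|A (x k) - y|].  The implicit step is a
    resolvent of a monotone operator, which gives the energy estimate
    [energy_step]: [`|x k - xs|] increases by at most [theta k], and, up to a
    multiple of [theta k], its square drops by [2 * lambdak k * p k.+1 ^+ 2]
    or more.  Hence
    [`|x k - xs|] converges, [lambdak k * p k.+1 ^+ 2] is summable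
    ([energy_cvg]), and the residuals tend to 0 ([residual_cvg0]).

    Strong convergence is a Cauchy argument.  Since
    [`|u - v|^2 = `|u - xs|^2 - `|v - xs|^2 - 2 <u - v, v - xs>] and the first
    two terms nearly cancel far along the sequence, it is enough to control
    [<x n - x l, x l - xs>].  Moving [A^*] across, each step from [k] to [k.+1]
    contributes at most [lambdak k * p k.+1 * p l] up to a multiple of
    [theta k].  This is summable in [k] provided [p l <= p k.+1]
    ([step_dot_le]), so any two iterates [x m] and [x n] are compared through
    the iterate of least residual between them ([cvg_of_pivots]).

    The limit solves the equation because [A] is continuous.  Every
    displacement is orthogonal to [ker A], because the range of [A^*] is and
    the inertial terms are multiples of earlier displacements; so the limit
    minus [x 0] is orthogonal to [ker A], which by Pythagoras singles out the
    [x 0]-minimal norm solution ([orthogonal_solution_min_norm]). *)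

(** * Inner products inducing the norm *)

Section InnerProduct.
Context {R : realType} {X : normedModType R}.
Variable dot : {dot X for (idfun : R -> R)}.
Hypothesis hilb : induces_norm dot.

Lemma dotxx (u : X) : dot u u = `|u| ^+ 2.
Proof.
rewrite hilb sqr_sqrtr//.
have [->|u0] := eqVneq u 0; first by rewrite linear0l.
exact/ltW/neq0_dnorm_gt0.
Qed.

Lemma dotBl (u v z : X) : dot (u - v) z = dot u z - dot v z.
Proof. exact: linearBl. Qed.

Lemma dotZl (a : R) (u z : X) : dot (a *: u) z = a * dot u z.
Proof. exact: linearZl_LR. Qed.

Lemma dotNr (u v : X) : dot u (- v) = - dot u v.
Proof. exact: linearNr. Qed.

Lemma dotC (u v : X) : dot u v = dot v u.
Proof. by rewrite (hermC dot) expr0 mul1r. Qed.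

Lemma sqr_normD (u v : X) :
  `|u + v| ^+ 2 = `|u| ^+ 2 + 2 * dot u v + `|v| ^+ 2.
Proof.
by rewrite -!dotxx linearDl !linearDr/= (dotC v u); ring.
Qed.

(** Cauchy-Schwarz is the squared triangle inequality of the given norm,
    expanded through the inner product. *)
Lemma dot_le_norm (u v : X) : dot u v <= `|u| * `|v|.
Proof.
have : `|u + v| ^+ 2 <= (`|u| + `|v|) ^+ 2.
  by rewrite ler_sqr ?nnegrE ?addr_ge0// ler_normD.
by rewrite sqr_normD; nra.
Qed.

Lemma norm_dot_le (u v : X) : `|dot u v| <= `|u| * `|v|.
Proof.
rewrite ler_norml dot_le_norm andbT lerNl.
by rewrite -(normrN u) -linearNl dot_le_norm.
Qed.

Lemma dot_continuousl (v : X) : continuous (fun u => dot u v).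
Proof.
move=> u; apply/cvgrPdist_le => e e0.
have v1 : 0 < `|v| + 1 by rewrite ltr_wpDl.
near=> t.
rewrite -linearBl; apply: (le_trans (norm_dot_le _ _)).
have : `|u - t| <= e / (`|v| + 1).
  near: t; apply: cvgr_dist_le; first exact: cvg_id.
  by rewrite divr_gt0.
rewrite ler_pdivlMr//; apply: le_trans.
by rewrite ler_wpM2l// lerDl.
Unshelve. all: by end_near. Qed.

End InnerProduct.

(** * Sequences *)

Section RealSequences.
Context {R : realType}.
Implicit Types (a b phi sigma : nat -> R).

Lemma series_le_limn b k :
  (forall n, 0 <= b n) -> cvgn (series b) -> series b k <= limn (series b).
Proof.
move=> b0 cb; apply: nondecreasing_cvgn_le => //.
exact: nondecreasing_series.
Qed.

(** Adding to [phi] the amounts [a] already lost and subtracting the amounts [b]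
    that may have been gained leaves a nonincreasing sequence. *)
Lemma cvg_quasi_decreasing phi a b :
  (forall k, 0 <= phi k) -> (forall k, 0 <= a k) -> (forall k, 0 <= b k) ->
  cvgn (series b) -> (forall k, phi k.+1 + a k <= phi k + b k) ->
  cvgn phi /\ cvgn (series a).
Proof.
move=> phi0 a0 b0 cb step.
have bnd k : phi k + series a k <= phi 0%N + series b k.
  elim: k => [|k IH]; first by rewrite !/series/= !big_geq.
  by rewrite !seriesSr; have := step k; lra.
have ca : cvgn (series a).
  apply: nondecreasing_is_cvgn; first exact: nondecreasing_series.
  exists (phi 0%N + limn (series b)) => _ [k _ <-].
  by have := bnd k; have := series_le_limn k b0 cb; have := phi0 k; lra.
split=> //.
pose v k := phi k + series a k - series b k.
have cv : cvgn v.
  apply: nonincreasing_is_cvgn.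
    apply/nonincreasing_seqP => k; rewrite /v !seriesSr.
    by have := step k; lra.
  exists (- limn (series b)) => _ [k _ <-]; rewrite /v.
  have : 0 <= series a k by apply: sumr_ge0.
  by have := series_le_limn k b0 cb; have := phi0 k; lra.
have -> : phi = (v \- series a) \+ series b.
  by apply/funext => k /=; rewrite /v; ring.
by apply: is_cvgD => //; apply: is_cvgB.
Qed.

Lemma norm_telescope_le {V : normedModType R} (f : nat -> V) sigma m n :
  (m <= n)%N -> (forall k, (m <= k < n)%N -> `|f k.+1 - f k| <= sigma k) ->
  `|f n - f m| <= series sigma n - series sigma m.
Proof.
move=> mn le_step; rewrite sub_series_geq// -telescope_sumr//.
apply: (le_trans (ler_norm_sum _ _ _)); apply: ler_sum_nat => k.
exact: le_step.
Qed.

Lemma exists_min_between (p : nat -> R) m n : (m <= n)%N ->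
  exists2 l, (m <= l <= n)%N & forall j, (m <= j <= n)%N -> p l <= p j.
Proof.
elim: n => [|n IH]; first by rewrite leqn0 => /eqP ->; exists 0%N => // -[].
rewrite leq_eqVlt => /predU1P[->|];
  first by exists n.+1; [rewrite !leqnn|move=> j; rewrite -eqn_leq => /eqP<-].
rewrite ltnS => mn; have [l /andP[ml ln] lmin] := IH mn.
have [le_p|/ltW le_p] := leP (p l) (p n.+1).
  exists l; first by rewrite ml leqW.
  move=> j /andP[mj]; rewrite leq_eqVlt => /predU1P[->//|jn].
  by apply: lmin; rewrite mj.
exists n.+1; first by rewrite leqW//=.
move=> j /andP[mj]; rewrite leq_eqVlt => /predU1P[->//|jn].
by apply: (le_trans le_p); apply: lmin; rewrite mj.
Qed.

End RealSequences.

(** A Cauchy criterion for sequences whose increments can only be estimated from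
    an endpoint at which [p] is least: two arbitrary indices are joined through
    the minimizer of [p] between them, which is the good endpoint of both
    halves. *)
Lemma cvg_of_pivots {R : realType} {X : completeNormedModType R}
    (x : nat -> X) (p phi s : nat -> R) :
  cvgn phi -> cvgn s ->
  (forall m n, (m <= n)%N ->
    (forall j, (m <= j <= n)%N -> p m <= p j) \/
    (forall j, (m <= j <= n)%N -> p n <= p j) ->
    `|x n - x m| ^+ 2 <= `|phi n - phi m| + `|s n - s m|) ->
  cvgn x.
Proof.
move=> cphi cs dist_le; apply/cauchy_cvgP/cauchy_exP => e e0.
(* In the tail, phi and s both vary by at most 2 * d, so a squared distance
   given by [dist_le] is at most 4 * d = e ^+ 2 / 8, which is below
   (e / 2) ^+ 2. *)
pose d := e ^+ 2 / 32.
have d0 : 0 < d by rewrite divr_gt0// exprn_gt0.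
have tail (u : nat -> R) : cvgn u ->
    \forall N \near \oo, forall m n, (N <= m)%N -> (N <= n)%N ->
      `|u n - u m| <= 2 * d.
  move=> /cvgrPdist_le/(_ _ d0)[N _ uN]; exists N => // M /= NM m n Mm Mn.
  have := uN m (leq_trans NM Mm); have := uN n (leq_trans NM Mn) => /= un um.
  rewrite -(subrKA (limn u)) (le_trans (ler_normD _ _))// (distrC (u n)).
  by rewrite mulr_natl mulr2n lerD.
have [N _ /(_ N (leqnn N))[phiN sN]] := filterI (tail _ cphi) (tail _ cs).
exists (x N), N => // n /= Nn.
rewrite -ball_normE/= distrC.
have [l /andP[Nl ln] l_min] := exists_min_between p Nn.
have half a b : (N <= a)%N -> (N <= b)%N -> (a <= b)%N ->
    (forall j, (a <= j <= b)%N -> p a <= p j) \/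
    (forall j, (a <= j <= b)%N -> p b <= p j) -> `|x b - x a| < e / 2.
  move=> Na Nb ab /(dist_le _ _ ab) sqr_le.
  rewrite -ltr_sqr ?nnegrE ?divr_ge0// ?ltW//.
  have := phiN _ _ Na Nb; have := sN _ _ Na Nb.
  by rewrite /d in d0 *; nra.
rewrite -(subrKA (x l)) (le_lt_trans (ler_normD _ _))// (splitr e) ltrD//.
  apply: half => //; left=> j /andP[lj jn].
  by apply: l_min; rewrite (leq_trans Nl).
apply: half => //; right=> j /andP[Nj jl].
by apply: l_min; rewrite Nj (leq_trans jl).
Qed.

(** * Iterated Tikhonov with summable perturbations *)

Section PerturbedTikhonov.
Context {R : realType} {X Y : completeNormedModType R}.
Variables (dotX : {dot X for (idfun : R -> R)}).
Variables (dotY : {dot Y for (idfun : R -> R)}).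
Hypotheses (hilbX : induces_norm dotX) (hilbY : induces_norm dotY).
Variables (A : {linear X -> Y}) (Astar : Y -> X).
Hypothesis A_adjoint : is_adjoint dotX dotY A Astar.
Variables (y : Y) (xs : X).
Hypothesis solves : A xs = y.
Variables (lambda : R) (lambdak theta : nat -> R) (i x : nat -> X).
Hypotheses (lambda_gt0 : 0 < lambda) (lambda_le : forall k, lambda <= lambdak k).
Hypotheses (i_le : forall k, `|i k| <= theta k) (theta_cvg : cvgn (series theta)).
Hypothesis step :
  forall k, x k.+1 = x k + i k - lambdak k *: Astar (A (x k.+1) - y).

Let p k := `|A (x k) - y|.

Lemma lambdak_ge0 k : 0 <= lambdak k.
Proof. exact/ltW/(lt_le_trans lambda_gt0). Qed.

Lemma theta_ge0 k : 0 <= theta k.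
Proof. exact: le_trans (i_le k). Qed.

Lemma displacementE k :
  x k.+1 - x k = i k - lambdak k *: Astar (A (x k.+1) - y).
Proof. by rewrite {1}step -[x k + i k - _]addrA [x k + (_ - _)]addrC addrK. Qed.

Lemma dissipation_ge0 k : 0 <= 2 * lambdak k * p k.+1 ^+ 2.
Proof.
by apply: mulr_ge0 (sqr_ge0 _); rewrite mulr_ge0 ?lambdak_ge0.
Qed.

Lemma residualE k : A (x k) - y = A (x k - xs).
Proof. by rewrite linearB solves. Qed.

(** The point before the implicit step is [x k.+1 - xs] plus
    [lambdak k *: A^* A (x k.+1 - xs)]; since [A^* A] is monotone, expanding its
    squared norm leaves the residual as the cross term. *)
Lemma energy_step k :
  `|x k.+1 - xs| ^+ 2 + 2 * lambdak k * p k.+1 ^+ 2 <=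
  (`|x k - xs| + theta k) ^+ 2.
Proof.
set r := A (x k.+1) - y.
have forward : (x k - xs) + i k = (x k.+1 - xs) + lambdak k *: Astar r.
  by rewrite step -/r [RHS]addrAC subrK addrAC.
have le_forward : `|x k - xs + i k| ^+ 2 <= (`|x k - xs| + theta k) ^+ 2.
  rewrite ler_sqr ?nnegrE ?addr_ge0 ?theta_ge0//.
  by rewrite (le_trans (ler_normD _ _))// lerD2l.
apply: le_trans le_forward; rewrite forward (sqr_normD hilbX (x k.+1 - xs)).
rewrite (dotC dotX _ (_ *: _)) dotZl dotC -A_adjoint -residualE -/r.
rewrite (dotxx hilbY) -/(p k.+1).
by rewrite -mulrA lerDl sqr_ge0.
Qed.

Let B := `|x 0%N - xs| + limn (series theta).

Lemma dist_bounded k : `|x k - xs| <= B.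
Proof.
apply: (@le_trans _ _ (`|x 0%N - xs| + series theta k)); last first.
  by rewrite lerD2l; apply: series_le_limn => //; exact: theta_ge0.
elim: k => [|k IH]; first by rewrite /series/= big_geq// addr0.
rewrite seriesSr addrA; apply: le_trans (lerD IH (lexx _)).
rewrite -ler_sqr ?nnegrE ?addr_ge0 ?theta_ge0//.
by apply: le_trans (energy_step k); rewrite lerDl dissipation_ge0.
Qed.

(** Boundedness of the errors turns [(`|x k - xs| + theta k) ^+ 2] into
    [`|x k - xs| ^+ 2] plus a fixed multiple of [theta k], so the squared errors
    decrease up to a summable amount. *)
Lemma energy_cvg :
  cvgn (fun k => `|x k - xs| ^+ 2) /\
  cvgn (series (fun k => 2 * lambdak k * p k.+1 ^+ 2)).
Proof.
pose C := 2 * B + limn (series theta).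
apply: (@cvg_quasi_decreasing _ _ _ (C *: theta)).
- by move=> k; exact: sqr_ge0.
- exact: dissipation_ge0.
- move=> k; rewrite /= mulr_ge0 ?theta_ge0// addr_ge0 ?mulr_ge0 //.
    exact: le_trans (dist_bounded 0).
  apply: le_trans (series_le_limn 0 theta_ge0 theta_cvg).
  by rewrite /series/= big_geq.
- exact: is_cvg_seriesZ.
- move=> k; apply: (le_trans (energy_step k)).
  have theta_le : theta k <= limn (series theta).
    apply: le_trans (series_le_limn k.+1 theta_ge0 theta_cvg).
    by rewrite seriesSr lerDr sumr_ge0// => j _; exact: theta_ge0.
  rewrite /C /=.
  have := dist_bounded k; have := theta_ge0 k; have := normr_ge0 (x k - xs).
  change (((2 * B + limn (series theta)) *: theta) k)
    with ((2 * B + limn (series theta)) * theta k).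
  by move=> *; nra.
Qed.

Lemma residual_cvg0 : p @ \oo --> 0.
Proof.
have [_ /cvg_series_cvg_0 to0] := energy_cvg.
apply/cvgrPdist_lt => e e0.
have c0 : 0 < 2 * lambda * e ^+ 2 by rewrite !mulr_gt0 ?exprn_gt0.
have /cvgrPdist_lt/(_ _ c0)[N _ small] := to0.
exists N.+1 => // -[//|k] /= Nk; have := small k Nk; rewrite !sub0r !normrN.
rewrite ger0_norm ?dissipation_ge0// (ger0_norm (normr_ge0 _)) => h.
rewrite -ltr_sqr ?nnegrE ?(ltW e0)//.
rewrite -(ltr_pM2l (x := 2 * lambda)) ?mulr_gt0//; apply: le_lt_trans h.
by rewrite ler_wpM2r ?sqr_ge0// ler_wpM2l.
Qed.

(** Moving [A^*] across the inner product produces the product of residuals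
    [p k.+1 * p l]; comparing it with the summable [p k.+1 ^+ 2] is the reason
    for choosing [l] with a small residual. *)
Lemma step_dot_le k (l : nat) : p l <= p k.+1 ->
  `|dotX (x k.+1 - x k) (x l - xs)| <= lambdak k * p k.+1 ^+ 2 + B * theta k.
Proof.
move=> le_p.
rewrite displacementE dotBl dotZl (dotC _ (Astar _)) -A_adjoint -residualE.
rewrite (le_trans (ler_normB _ _))// addrC lerD//.
  rewrite normrM ger0_norm ?lambdak_ge0// ler_wpM2l ?lambdak_ge0//.
  rewrite (le_trans (norm_dot_le hilbY _ _))// -/(p l) -/(p k.+1) expr2.
  by rewrite ler_wpM2r ?normr_ge0.
rewrite (le_trans (norm_dot_le hilbX _ _))// mulrC.
by rewrite ler_pM// dist_bounded.
Qed.

Lemma perturbed_tikhonov_cvg : cvgn x.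
Proof.
have [phi_cvg p_cvg] := energy_cvg.
pose sigma k := 2 * lambdak k * p k.+1 ^+ 2 + 2 * B * theta k.
have s_cvg : cvgn (series sigma).
  have -> : sigma =
    (fun k => 2 * lambdak k * p k.+1 ^+ 2) \+ (2 * B) *: theta by [].
  by rewrite seriesD; apply: is_cvgD => //; exact: is_cvg_seriesZ.
apply: (cvg_of_pivots (p := p) phi_cvg s_cvg) => m n mn pivot.
have dot_le l : (forall j, (m <= j <= n)%N -> p l <= p j) ->
    2 * `|dotX (x n - x m) (x l - xs)| <= `|series sigma n - series sigma m|.
  move=> l_min; apply: le_trans (ler_norm _).
  pose f k := 2 * dotX (x k) (x l - xs).
  have -> : 2 * `|dotX (x n - x m) (x l - xs)| = `|f n - f m|.
    by rewrite /f -mulrBr -dotBl normrM normr_nat.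
  apply: norm_telescope_le => // k /andP[mk kn].
  rewrite /f -mulrBr -dotBl normrM normr_nat.
  have /step_dot_le : p l <= p k.+1 by apply: l_min; rewrite kn leqW.
  by rewrite /sigma; lra.
(* The difference of squared errors is expanded around the endpoint of least
   residual, which is x m in the first case and x n in the second. *)
have nE : x n - xs = (x m - xs) + (x n - x m) by rewrite [RHS]addrC subrKA.
have mE : x m - xs = (x n - xs) + - (x n - x m).
  by rewrite opprB [RHS]addrC subrKA.
case: pivot => /dot_le.
  have := sqr_normD hilbX (x m - xs) (x n - x m); rewrite -nE (dotC _ (x m - xs)).
  move: (dotX _ _) => D; move=> -> h.
  have := ler_norm (- D); rewrite normrN.
  have := ler_norm (`|x m - xs| ^+ 2 + 2 * D + `|x n - x m| ^+ 2 - `|x m - xs| ^+ 2).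
  lra.
have := sqr_normD hilbX (x n - xs) (- (x n - x m)).
rewrite -mE dotNr dotC normrN.
move: (dotX _ _) => D; move=> -> h.
have := ler_norm D.
have := ler_norm
  (- (`|x n - xs| ^+ 2 - (`|x n - xs| ^+ 2 + 2 * - D + `|x n - x m| ^+ 2))).
rewrite normrN; lra.
Qed.

Lemma perturbed_tikhonov_solves : bounded_operator A -> A (limn x) = y.
Proof.
move=> [M A_le].
have A_cont : continuous A.
  apply: bounded_linear_continuous; apply/linear_boundedP; near=> r => u.
  by rewrite (le_trans (A_le u))// ler_wpM2r.
have Ax_lim : A (x k) @[k --> \oo] --> A (limn x).
  exact: (continuous_cvg _ (A_cont _) perturbed_tikhonov_cvg).
have Ax_y : A (x k) @[k --> \oo] --> y.
  exact/subr_cvg0/norm_cvg0P/residual_cvg0.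
exact: cvg_unique Ax_lim Ax_y.
Unshelve. all: by end_near. Qed.

(** The range of [A^*] is orthogonal to [ker A], so a step can leave the
    orthogonal complement of [ker A] only through its perturbation. *)
Lemma step_orthogonal (z : X) k : A z = 0 ->
  dotX (i k) z = 0 -> dotX (x k.+1 - x k) z = 0.
Proof.
move=> Az0 i_orth.
by rewrite displacementE dotBl dotZl i_orth dotC -A_adjoint Az0 linear0l mulr0 subrr.
Qed.

Lemma perturbed_tikhonov_orthogonal (z : X) : A z = 0 ->
  (forall k, dotX (i k) z = 0) -> dotX (limn x - x 0%N) z = 0.
Proof.
move=> Az0 i_orth.
have x_orth k : dotX (x k - x 0%N) z = 0.
  elim: k => [|k IH]; first by rewrite subrr linear0l.
  by rewrite -(subrKA (x k)) linearDl/= IH step_orthogonal// addr0.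
have x_lim : x k - x 0%N @[k --> \oo] --> limn x - x 0%N.
  by apply: cvgB; [exact: perturbed_tikhonov_cvg | exact: cvg_cst].
have dot_lim : dotX (x k - x 0%N) z @[k --> \oo] --> dotX (limn x - x 0%N) z.
  exact: (continuous_cvg _ (@dot_continuousl _ _ _ hilbX z _) x_lim).
have dot_0 : dotX (x k - x 0%N) z @[k --> \oo] --> 0.
  by under eq_fun do rewrite x_orth; exact: cvg_cst.
exact: cvg_unique dot_lim dot_0.
Qed.

End PerturbedTikhonov.

(** * Minimal norm solutions and the inertial rule *)

(** Any other solution differs from [xb] by an element of [ker A], so Pythagoras
    gives [`|u - x0|^2 = `|xb - x0|^2 + `|u - xb|^2]. *)
Lemma orthogonal_solution_min_norm {R : realType} {X Y : completeNormedModType R}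
    (dotX : {dot X for (idfun : R -> R)}) (hilbX : induces_norm dotX)
    (A : {linear X -> Y}) (y : Y) (x0 xb : X) :
  A xb = y -> (forall z, A z = 0 -> dotX (xb - x0) z = 0) ->
  unique (min_norm_solution A y x0) xb.
Proof.
move=> Axb orth.
have pyth u : A u = y -> `|u - x0| ^+ 2 = `|xb - x0| ^+ 2 + `|u - xb| ^+ 2.
  move=> Au; have -> : u - x0 = (xb - x0) + (u - xb) by rewrite [RHS]addrC subrKA.
  by rewrite (sqr_normD hilbX (xb - x0)) orth ?mulr0 ?addr0// linearB Au Axb subrr.
have inf_eq : `|xb - x0| = inf [set `|u - x0| | u in [set u | A u = y]].
  have lb : lbound [set `|u - x0| | u in [set u | A u = y]] `|xb - x0|.
    move=> _ [u /= Au <-].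
    by rewrite -ler_sqr ?nnegrE// (pyth u Au) lerDl sqr_ge0.
  apply/eqP; rewrite eq_le; apply/andP; split.
    by apply: lb_le_inf => //; exists `|xb - x0|, xb.
  by apply: ge_inf; [exists `|xb - x0| | exists xb].
split=> // u [Au u_inf].
have := pyth u Au; rewrite u_inf -inf_eq => /esym/eqP.
by rewrite -subr_eq0 addrAC subrr add0r sqrf_eq0 normr_eq0 subr_eq0 => /eqP.
Qed.

(** The cap [theta / d ^+ 2], with [d] the last displacement, bounds [a * d] by
    [theta] when [d >= 1], and the cap [theta] does so when [d <= 1].  At the
    first step [a = alpha] is not capped, but there [x 0] is its own predecessor
    and the displacement vanishes. *)
Lemma inertia_le {R : realType} {X : completeNormedModType R}
    (alpha theta a : R) (x : nat -> X) (k : nat) :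
  0 <= theta -> 0 <= a ->
  a = (if k == 0%N then alpha
       else if 0 < `|x k - previous x k| then
         Num.min (Num.min (theta / `|x k - previous x k| ^+ 2) theta) alpha
       else 0) ->
  `|a *: (x k - previous x k)| <= theta.
Proof.
move=> theta0 a0; case: k => [|k] /=; first by rewrite subrr scaler0 normr0.
case: ifPn => [d0 aE|_ ->]; last by rewrite scale0r normr0.
rewrite normrZ (ger0_norm a0); move: `|_| d0 aE => d d0 aE.
have a_le : a <= theta by rewrite aE !ge_min lexx orbT.
have a_le_div : a * d ^+ 2 <= theta.
  by rewrite -ler_pdivlMr ?exprn_gt0// aE !ge_min lexx.
have [d1|/ltW d1] := leP d 1.
  by apply: le_trans a_le; rewrite ler_piMr.
by apply: le_trans a_le_div; rewrite ler_wpM2l// expr2 ler_peMr// ltW.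
Qed.

Theorem theorem2p8 (R : realType) (X Y : completeNormedModType R)
    (dotX : {dot X for (idfun : R -> R)}) (dotY : {dot Y for (idfun : R -> R)})
    (hilbX : induces_norm dotX) (hilbY : induces_norm dotY)
    (A : {linear X -> Y}) (A_bounded : bounded_operator A)
    (A_ill_posed : ill_posed A)
    (Astar : Y -> X) (A_adjoint : is_adjoint dotX dotY A Astar)
    (y : Y) (y_range : range A y) (x0 : X)
    (alpha : R) (lambdak alphak : nat -> R) (x w : nat -> X)
    (run : iniT A Astar y x0 alpha lambdak alphak x w)
    (A1 : exists theta : nat -> R,
       [/\ forall k : nat, 0 <= theta k,
           cvgn (series theta) &
           inertia_rule A y alpha theta alphak x])
    (A2 : inertia_nonincreasing A y alphak x /\ alpha < 1 / 2)
    (A3 : exists lambda : R, 0 < lambda /\ forall k : nat, lambda <= lambdak k) :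
  (exists k0 : nat, stops_at A y x k0) \/
  ((forall k : nat, 0 < `|A (x k) - y|) /\
   exists xdag : X,
     unique (min_norm_solution A y x0) xdag /\ (x k @[k --> \oo] --> xdag)).
Proof.
case: run => x0E _ _ runk.
have [[k0 Axk0]|not_solved] := pselect (exists k, A (x k) = y).
  left; have ex : exists k, `[< A (x k) = y >] by exists k0; apply/asboolP.
  case: (ex_minnP ex) => k1 /asboolP Axk1 min_k1; exists k1; split=> // j jk1.
  rewrite normr_gt0 subr_eq0; apply/eqP => Axj.
  by have := min_k1 j; rewrite leqNgt jk1 => /(_ (asboolT Axj)).
right.
have pos k : 0 < `|A (x k) - y|.
  by rewrite normr_gt0 subr_eq0; apply/eqP => Axk; apply: not_solved; exists k.
split=> //.
have act k : active A y x k by move=> j _; exact: pos.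
have [theta [theta_ge0 theta_cvg rule]] := A1.
have [lambda [lambda_gt0 lambda_le]] := A3.
have [xs _ Axs] := y_range.
pose i k := alphak k *: (x k - previous x k).
have i_le k : `|i k| <= theta k.
  have [/andP[a_ge0 _] _ _] := runk k (act k).
  exact: inertia_le (theta_ge0 k) a_ge0 (rule k (act k)).
have step k : x k.+1 = x k + i k - lambdak k *: Astar (A (x k.+1) - y).
  have [_ wE /eqP] := runk k (act k).
  by rewrite subr_eq0 addrC => /eqP; rewrite wE -/(i k) => <-; rewrite addrK.
have x_cvg := perturbed_tikhonov_cvg hilbX hilbY A_adjoint Axs lambda_gt0
  lambda_le i_le theta_cvg step.
exists (limn x); split=> //.
apply: (orthogonal_solution_min_norm hilbX).
  exact: (perturbed_tikhonov_solves hilbX hilbY A_adjoint Axs lambda_gt0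
    lambda_le i_le theta_cvg step).
move=> z Az0; rewrite -x0E.
apply: (perturbed_tikhonov_orthogonal hilbX hilbY A_adjoint Axs lambda_gt0
    lambda_le i_le theta_cvg step) => // k.
rewrite /i dotZl; suff -> : dotX (x k - previous x k) z = 0 by rewrite mulr0.
(* x 0 is its own predecessor, so the first displacement is 0. *)
elim: k => [|k IH] /=; first by rewrite subrr linear0l.
apply: (step_orthogonal A_adjoint step) => //.
by rewrite /i dotZl IH mulr0.
Qed.
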